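(* Let $G=C(7)\rtimes C(3)$ be the non-abelian group of order $21$, and let $\Psi(f)=\wedge f-1$ on complex valued class functions on $G$. (a) If $u$ is a class function with $u(1)=1$, then $\Psi(u)$ takes the same value $2^{\frac17+\frac37(u(7A)+u(7B))}-1$ on the two classes $7A$ and $7B$. In particular, on the common value $z=u(7A)=u(7B)$ the transformation $\Psi$ takes the form $\psi(z)=2^{\frac17+\frac67z}-1$. (b) The fixed point equation $\psi(z)=z$ is equivalent to $we^w=-\frac67\,2^{-\frac57}\log 2$, where $w=-\frac67(1+z)\log2$. (c) The equation $\psi(z)=z$ has exactly two real solutions: $z=1$, which corresponds to the branch $W_{-1}$ of the Lambert function, and $$z_0=-\frac{7\,W\left(-\frac37\,2^{2/7}\log 2\right)}{6\log 2}-1\ \sim\ 0.401664,$$ which corresponds to the principal branch $W$. The fixed point $1$ is repulsive for $\psi$, with $\psi'(1)=\frac{12\log2}{7}>1$, while $z_0$ is an attracting fixed point of $\psi$. (d) The fixed point $z_0$ gives a class function $f$ on $G$ with $f(7A)=f(7B)=z_0$ which satisfies $\wedge f=1+f$, $f(g^{-1})=\overline{f(g)}$ for all $g\in G$, and $f(1)=1$, but which is not the character of a representation of $G$ of dimension $1$.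
   Context: $C(n)$ is the cyclic group of order $n$; $C(3)$ acts non-trivially on $C(7)$. $G$ has five conjugacy classes: the trivial class, two classes $7A,7B$ of elements of order $7$ (size $3$ each, interchanged by $g\mapsto g^{-1}$), and two classes $3A,3B$ of elements of order $3$ (size $7$ each, interchanged by $g\mapsto g^{-1}$). For a class function $u$, $u(7A)$ etc. denotes its value on that class, and $u(1)$ its value at the identity. For a finite group $G$ of odd order $k$, the wedge operation on complex valued class functions $f$ on $G$ is defined by $$\wedge(f)(g)=\exp\Big(\sum_{j=1}^k c_j f(g^j)\Big),\quad c_j=(-1)^{j+1}\frac{H(j/k)}{k},\quad H(u)=\sum_{m=0}^\infty\frac{(-1)^m}{m+u}\ (u>0),$$ and $1$ denotes the constant function. Here $k=21$. $W$ and $W_{-1}$ are the two real branches of the Lambert function on $[-1/e,0)$: for $u$ in this interval, $W(u)\ge -1$ and $W_{-1}(u)\le-1$ are the real solutions $w$ of $we^w=u$. A fixed point $p$ of $\psi$ is attracting if $|\psi'(p)|<1$ and repulsive if $|\psi'(p)|>1$. *)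

(* Defs.v *)
From HB Require Import structures.
From mathcomp Require Import all_boot all_order all_algebra.
From mathcomp Require Import all_fingroup all_solvable all_character.
From mathcomp Require Import complex.
From mathcomp Require Import all_classical all_reals all_analysis.

Set Implicit Arguments.
Unset Strict Implicit.
Unset Printing Implicit Defensive.

Import Order.TTheory GRing.Theory Num.Theory.
Import numFieldNormedType.Exports.

Local Open Scope ring_scope.
Local Open Scope complex_scope.
Local Open Scope classical_set_scope.

(* exp (x + i y) = e^x (cos y + i sin y) *)
Definition cexp (R : realType) (w : R[i]) : R[i] :=
  let: x +i* y := w in (expR x * cos y) +i* (expR x * sin y).

(* a^w for a real base a > 0 and a complex exponent w *)
Definition cpow (R : realType) (a : R) (w : R[i]) : R[i] :=
  cexp (w * (ln a)%:C).

(* Functions are total on the ambient type gT; only their values on G matter.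
   The class functions 'CF(G) of the library take their values in algC. *)
Definition is_classfun (gT : finGroupType) (G : {group gT}) (T : Type)
    (f : gT -> T) : Prop :=
  forall x y, x \in G -> y \in G -> f (x ^ y)%g = f x.

Definition altH (R : realType) (u : R) : R :=
  limn (series (fun m => (-1) ^+ m / (m%:R + u))).

Definition wedge_coef (R : realType) (k j : nat) : R :=
  (-1) ^+ j.+1 * (altH (j%:R / k%:R : R) / k%:R).

Definition wedge (R : realType) (gT : finGroupType) (G : {group gT})
    (f : gT -> R[i]) (g : gT) : R[i] :=
  cexp (\sum_(1 <= j < #|G|.+1) (wedge_coef R #|G| j)%:C * f (g ^+ j)%g).

Definition Psi (R : realType) (gT : finGroupType) (G : {group gT})
    (f : gT -> R[i]) : gT -> R[i] :=
  fun g => wedge G f g - 1.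

Lemma Psi_classfun (R : realType) (gT : finGroupType) (G : {group gT})
    (f : gT -> R[i]) : is_classfun G f -> is_classfun G (Psi G f).
Proof.
move=> fG x y xG yG; rewrite /Psi /wedge; congr (cexp _ - 1).
by apply: eq_bigr => j _; rewrite -conjXg fG // groupX.
Qed.

Definition psiC (R : realType) (z : R[i]) : R[i] :=
  cpow 2 (1 / 7 + 6 / 7 * z) - 1.

Definition psi (R : realType) (x : R) : R :=
  2 `^ (1 / 7 + 6 / 7 * x) - 1.

Lemma psiC_real (R : realType) (x : R) : psiC x%:C = (psi x)%:C.
Proof.
rewrite /psiC /cpow.
have -> : (1 / 7 + 6 / 7 * x%:C) * (ln 2)%:C =
          ((1 / 7 + 6 / 7 * x) * ln 2)%:C :> R[i].
  by rewrite !(rmorphM, rmorphD, fmorphV, rmorph_nat, rmorph1).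
rewrite /cexp /= cos0 sin0 mulr1 mulr0 /psi /powR pnatr_eq0 /=.
by rewrite [in RHS]rmorphB rmorph1.
Qed.

(* The real branches of the Lambert function; meaningful for
   -1/e <= u < 0, where the defining sets are singletons. *)
Definition lambertW (R : realType) (u : R) : R :=
  get [set w : R | -1 <= w /\ w * expR w = u].

Definition lambertWm1 (R : realType) (u : R) : R :=
  get [set w : R | w <= -1 /\ w * expR w = u].

Definition attracting (R : realType) (f : R -> R) (p : R) : Prop :=
  [/\ f p = p, derivable f p 1 & `|f^`() p| < 1].

Definition repulsive (R : realType) (f : R -> R) (p : R) : Prop :=
  [/\ f p = p, derivable f p 1 & 1 < `|f^`() p|].

Definition lambert_arg (R : realType) : R := - (3 / 7) * 2 `^ (2 / 7) * ln 2.

Definition z0 (R : realType) : R :=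
  - (7 * lambertW (lambert_arg R) / (6 * ln 2)) - 1.

Definition is_linear_character (R : realType) (gT : finGroupType)
    (G : {group gT}) (f : gT -> R[i]) : Prop :=
  exists rG : mx_representation R[i] G 1,
    forall g, g \in G -> f g = \tr (rG g).

(* Main.v *)
(* Since H(u) has alternating terms, splitting its series by parity gives
   H(u) = log 2 + g(u) - g((1+u)/2) and H(u) = g(u/2) - g(u) - log 2, where
   g = -digamma is the limit of sum_(i<K) 1/(i+u) - log(K+u).  Hence
   k c_j = log 2 + g(j/k) - g(i/k) with i = j/2 modulo the odd number k, and the
   digamma terms cancel in every sum of the c_j over a set of residues stable under
   doubling.  For k = 21 the sets of j that are 0, squares, or non-squares modulo 7
   are stable, as 2 is a square modulo 7, so the c_j sum to 1/7, 3/7, 3/7 of log 2.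
   These sets are also the ones on which g^j is trivial, conjugate to g, or conjugate
   to g^-1, for g of order 7, because a^y = a^2 for some y.

   The real fixed points come from w e^w being decreasing on ]-oo, -1] and increasing
   on [-1, +oo[; z_0 is located by the intermediate value theorem between two rationals,
   with logarithms bounded by the series of artanh.  For (d), take f = z_0 on the
   elements of order 7 and 1 elsewhere; a linear character would satisfy
   f(a) = f(a^2) = f(a)^2, but z_0 is neither 0 nor 1. *)
Require Import Defs.
From HB Require Import structures.
From mathcomp Require Import all_boot all_order all_algebra.
From mathcomp Require Import all_fingroup all_solvable all_character.
From mathcomp Require Import complex.
From mathcomp Require Import all_classical all_reals all_analysis.
From mathcomp Require Import ring lra zify.

Import Order.TTheory GRing.Theory Num.Theory.
Import numFieldNormedType.Exports.

Local Open Scope ring_scope.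
Local Open Scope complex_scope.

(** * The digamma function and the series [altH] *)

Section ShiftedHarmonic.
Local Open Scope classical_set_scope.

Definition shifted_harmonic (R : realType) (u : R) (K : nat) : R :=
  \sum_(0 <= i < K) (i%:R + u)^-1.

(* Minus the digamma function. *)
Definition digamma_neg (R : realType) (u : R) : R :=
  limn (fun K => shifted_harmonic R u K - ln (K%:R + u)).

(** Both bounds are ln (1 + t) <= t, at t = 1/x and t = -1/(x + 1). They control the increments of
    the sequence defining [digamma_neg]. *)
Lemma ln_succ_bounds (R : realType) (x : R) : 0 < x ->
  (x + 1)^-1 <= ln (x + 1) - ln x <= x^-1.
Proof.
move=> x0; have x10 : 0 < x + 1 by lra.
rewrite -ln_div ?posrE//; apply/andP; split; last first.
  have -> : (x + 1) / x = 1 + x^-1 by field; lra.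
  by apply: le_ln1Dx; have : 0 < x^-1 by [rewrite invr_gt0]; lra.
rewrite -lerN2 -lnV ?posrE ?divr_gt0// invf_div.
have -> : x / (x + 1) = 1 + - (x + 1)^-1 by field; lra.
apply: le_ln1Dx; rewrite ltrN2 invf_lt1//; lra.
Qed.

Lemma cvg_digamma_neg (R : realType) (u : R) : 0 < u ->
  (fun K => shifted_harmonic R u K - ln (K%:R + u)) @ \oo --> digamma_neg R u.
Proof.
move=> u0; have p K : 0 < K%:R + u by rewrite ltr_wpDl.
have step K : (K.+1%:R + u : R) = K%:R + u + 1 by rewrite -natr1; ring.
apply: nondecreasing_is_cvgn.
  apply/nondecreasing_seqP => K; rewrite /shifted_harmonic big_nat_recr//=.
  by have := ln_succ_bounds R _ (p K); rewrite step; lra.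
exists (u^-1 - ln u) => _ [K _ <-].
(* Adding 1/(K + u) makes the sequence nonincreasing, so its value at K = 0 is an upper bound. *)
have : shifted_harmonic R u K - ln (K%:R + u) + (K%:R + u)^-1 <= u^-1 - ln u.
  elim: K => [|K IH]; first by rewrite /shifted_harmonic big_geq// sub0r mulr0n add0r; lra.
  apply: le_trans IH; rewrite /shifted_harmonic big_nat_recr//=.
  by have := ln_succ_bounds R _ (p K); rewrite step; lra.
by have : 0 < (K%:R + u)^-1 by [rewrite invr_gt0]; lra.
Qed.

Lemma cvgn_double (T : topologicalType) (x : nat -> T) (l : T) :
  x @ \oo --> l -> (fun n => x n.*2) @ \oo --> l.
Proof.
apply: cvg_comp => A [N _ hN]; exists N => // n /= Nn.
by apply: hN => /=; rewrite -addnn (leq_trans Nn)// leq_addl.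
Qed.

Lemma cvgn_even_odd (T : topologicalType) (x : nat -> T) (l : T) :
  (fun n => x n.*2) @ \oo --> l -> (fun n => x n.*2.+1) @ \oo --> l ->
  x @ \oo --> l.
Proof.
move=> he ho A nA; have [N _ hN] := he A nA; have [M _ hM] := ho A nA.
exists (maxn N M).*2 => //= n.
have := odd_double_half n; case: odd => /= <-; rewrite ?add1n ?add0n => h.
  by apply: hM => /=; lia.
by apply: hN => /=; lia.
Qed.

Lemma cvgn_inv_shift (R : realType) (u : R) :
  (fun n => (n%:R + u)^-1 : R) @ \oo --> (0 : R).
Proof.
apply/cvgr0Pnorm_lt => e e0; near=> n.
have ei : 0 < e^-1 by rewrite invr_gt0.
have : e^-1 - u < n%:R by near: n; exact: nbhs_infty_gtr.
rewrite ltrBlDr => h.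
by rewrite gtr0_norm ?invr_gt0 ?(lt_trans ei)// -(invrK e) ltf_pV2 ?posrE// (lt_trans ei).
Unshelve. all: by end_near. Qed.

(** The quotient (2K + u)/(K + v) is 2 + (u - 2v)/(K + v). The log 2 in the formulas for [altH]
    comes from here: harmonic sums of 2K and of K terms carry different logarithmic corrections. *)
Lemma cvgn_ln_ratio (R : realType) (u v : R) : 0 < u -> 0 < v ->
  (fun K => ln (K.*2%:R + u) - ln (K%:R + v)) @ \oo --> (ln 2 : R).
Proof.
move=> u0 v0.
have e K : ln (K.*2%:R + u) - ln (K%:R + v) =
    ln (2 + (u - 2 * v) * (K%:R + v)^-1) :> R.
  have k0 : (0 : R) <= K%:R by [].
  rewrite -ln_div ?posrE; [|by rewrite ltr_wpDl|by rewrite ltr_wpDl].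
  by congr ln; rewrite -muln2 natrM; field; lra.
under eq_fun do rewrite e.
have h : (fun K : nat => (2 + (u - 2 * v) * (K%:R + v)^-1 : R)) @ \oo --> (2 : R).
  have l2 : 2 + (u - 2 * v) * 0 = 2 by rewrite mulr0 addr0.
  rewrite -[X in _ --> X]l2.
  by apply: cvgD; [exact: cvg_cst|apply: cvgMl_tmp; exact: cvgn_inv_shift].
exact: (cvg_comp _ _ h (continuous_ln (ltr0n R 2))).
Qed.

(** The alternating sum is the full sum minus twice its odd-indexed terms, and also twice the
    even-indexed ones minus the full sum; halving denominators turns these into harmonic sums
    shifted by (1 + u)/2 and u/2. *)
Lemma alt_sum_double (R : realType) (u : R) (K : nat) : 0 < u ->
  series (fun m => (-1) ^+ m / (m%:R + u)) K.*2 =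
    shifted_harmonic R u K.*2 - shifted_harmonic R ((1 + u) / 2) K /\
  series (fun m => (-1) ^+ m / (m%:R + u)) K.*2 =
    shifted_harmonic R (u / 2) K - shifted_harmonic R u K.*2.
Proof.
move=> u0; rewrite /series /shifted_harmonic /=.
elim: K => [|K [IH1 IH2]]; first by rewrite !big_geq// subrr.
rewrite doubleS !(big_nat_recr K.*2.+1)//= !(big_nat_recr K.*2)//=.
rewrite !(big_nat_recr K)//=.
have k0 : (0 : R) <= K%:R by [].
have s0 : (-1) ^+ K.*2 = 1 :> R by rewrite -signr_odd odd_double.
have n0 : K.*2%:R = 2 * K%:R :> R by rewrite -mul2n natrM.
have n1 : K.*2.+1%:R = 2 * K%:R + 1 :> R by rewrite -natr1 n0.
by split; [rewrite IH1|rewrite IH2]; rewrite exprS s0 n0 n1; field; lra.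
Qed.

Lemma altH_digamma_neg (R : realType) (u : R) : 0 < u ->
  altH u = ln 2 + digamma_neg R u - digamma_neg R ((1 + u) / 2) /\
  altH u = digamma_neg R (u / 2) - digamma_neg R u - ln 2.
Proof.
move=> u0.
pose s : nat -> R := series (fun m => (-1) ^+ m / (m%:R + u)).
have cvg_eq (f g : nat -> R) (l : R) : g =1 f -> f @ \oo --> l -> g @ \oo --> l.
  by move=> /funext ->.
have u2 : 0 < u / 2 by lra.
have v2 : 0 < (1 + u) / 2 by lra.
have e1 : (fun n => s n.*2) @ \oo -->
    ln 2 + digamma_neg R u - digamma_neg R ((1 + u) / 2).
  have h := cvgB (cvgD (cvgn_ln_ratio R _ _ u0 v2)
     (cvgn_double _ _ _ (cvg_digamma_neg R u u0))) (cvg_digamma_neg R _ v2).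
  apply: (cvg_eq _ _ _ _ (h _ _)) => K.
  by rewrite !fctE /s (alt_sum_double R u K u0).1; ring.
have e2 : (fun n => s n.*2) @ \oo -->
    digamma_neg R (u / 2) - digamma_neg R u - ln 2.
  have h := cvgB (cvgB (cvg_digamma_neg R _ u2)
     (cvgn_double _ _ _ (cvg_digamma_neg R u u0))) (cvgn_ln_ratio R _ _ u0 u2).
  apply: (cvg_eq _ _ _ _ (h _ _)) => K.
  by rewrite !fctE /s (alt_sum_double R u K u0).2; ring.
(* [altH] is a limit over all partial sums; those of odd length differ by the term 1/(2n + u), which
   tends to 0. *)
have o1 : (fun n => s n.*2.+1) @ \oo -->
    ln 2 + digamma_neg R u - digamma_neg R ((1 + u) / 2).
  have h := cvgD e1 (cvgn_double _ _ _ (cvgn_inv_shift R u)).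
  rewrite addr0 in h; apply: (cvg_eq _ _ _ _ (h _)) => K.
  rewrite !fctE /s /series /= big_nat_recr//=.
  by rewrite -[X in _ + X / _]signr_odd odd_double expr0 mul1r.
have sl := cvg_lim (@Rhausdorff R) (cvgn_even_odd _ _ _ e1 o1).
by rewrite /altH -/s sl; split => //; exact: (cvg_unique _ e1 e2).
Qed.

End ShiftedHarmonic.

(** * The wedge coefficients, and their sums for k = 21 *)

(* [i] is half of [j] modulo [k]: the coefficient is a coboundary for the
   permutation [j |-> j / 2] up to the constant [ln 2]. *)
Lemma wedge_coef_digamma_neg (R : realType) (k j i : nat) :
  (0 < k)%N -> (0 < j)%N -> i.*2 = (j + odd j * k)%N ->
  wedge_coef R k j =
    (ln 2 + digamma_neg R (j%:R / k%:R) - digamma_neg R (i%:R / k%:R)) / k%:R.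
Proof.
move=> k0 j0 ij.
have kR : 0 < k%:R :> R by rewrite ltr0n.
have jR : 0 < j%:R / k%:R :> R by rewrite divr_gt0 ?ltr0n.
have [a1 a2] := altH_digamma_neg R _ jR.
have iE : i%:R = (j + odd j * k)%:R / 2 :> R.
  by rewrite -ij -mul2n natrM; field.
have k1 : k%:R != 0 :> R by rewrite lt0r_neq0.
rewrite /wedge_coef iE exprS -signr_odd /=.
case: (odd j) => /=; rewrite ?mul1n ?mul0n ?addn0 ?natrD.
- have <- : (1 + j%:R / k%:R) / 2 = (j%:R + k%:R) / 2 / k%:R :> R by field.
  by rewrite expr1 a1; ring.
- have <- : j%:R / k%:R / 2 = j%:R / 2 / k%:R :> R by field.
  by rewrite expr0 a2; ring.
Qed.

(* Halving modulo 21 permutes each of the sets of [j] on which [j mod 7] is zero,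
   a nonzero square, or a non-square, so the digamma values cancel on each. *)
Lemma sum_wedge_coef21 (R : realType) (F : nat -> R[i]) (p q : R[i]) :
  (forall j, F (j + 7)%N = F j) -> F 0%N = 1 ->
  F 1%N = p -> F 2%N = p -> F 4%N = p -> F 3%N = q -> F 5%N = q -> F 6%N = q ->
  \sum_(1 <= j < 22) (wedge_coef R 21 j)%:C * F j =
    (1 / 7 + 3 / 7 * (p + q)) * (ln 2)%:C.
Proof.
move=> F7 F0 F1 F2 F4 F3 F5 F6.
pose d j := (digamma_neg R (j%:R / 21%:R))%:C.
have c j i : (0 < j)%N -> i.*2 = (j + odd j * 21)%N ->
    (wedge_coef R 21 j)%:C = ((ln 2)%:C + d j - d i) / 21.
  move=> j0 ij; rewrite (wedge_coef_digamma_neg R 21 j i)//.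
  by rewrite !(rmorphM, rmorphD, rmorphN, fmorphV, rmorph_nat).
do 21! rewrite big_ltn//; rewrite big_geq//.
(* Each j is paired with its half modulo 21; j = 21 stands for the residue 0 and is its own half,
   (21 + 21)/2. *)
rewrite (c 1 11)%N// (c 2 1)%N// (c 3 12)%N// (c 4 2)%N// (c 5 13)%N// (c 6 3)%N//.
rewrite (c 7 14)%N// (c 8 4)%N// (c 9 15)%N// (c 10 5)%N// (c 11 16)%N// (c 12 6)%N//.
rewrite (c 13 17)%N// (c 14 7)%N// (c 15 18)%N// (c 16 8)%N// (c 17 19)%N// (c 18 9)%N//.
rewrite (c 19 20)%N// (c 20 10)%N// (c 21 21)%N//.
have F14 j : F (j + 14)%N = F j by rewrite -[RHS]F7 -[RHS]F7 -addnA.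
rewrite [F 21%N](F14 7%N) [F 20%N](F14 6%N) [F 19%N](F14 5%N) [F 18%N](F14 4%N).
rewrite [F 17%N](F14 3%N) [F 16%N](F14 2%N) [F 15%N](F14 1%N) [F 14%N](F14 0%N).
rewrite [F 13%N](F7 6%N) [F 12%N](F7 5%N) [F 11%N](F7 4%N) [F 10%N](F7 3%N).
rewrite [F 9%N](F7 2%N) [F 8%N](F7 1%N) [F 7%N](F7 0%N).
rewrite !(F0, F1, F2, F3, F4, F5, F6).
by field.
Qed.

(** * Monotonicity of w e^w and the real Lambert branches *)

Lemma mul_expR_lt (R : realType) (a b : R) : -1 <= a -> a < b ->
  a * expR a < b * expR b.
Proof.
move=> a1 ab; have t0 : a - b != 0 by lra.
suff h : a * expR (a - b) < b.
  have -> : expR a = expR (a - b) * expR b by rewrite -expRD subrK.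
  by rewrite mulrA ltr_pM2r ?expR_gt0.
have e1 := expR_gt1Dx t0.
(* With t = a - b, the case a < 0 uses a e^t < a (1 + t) = b + (a - b)(a + 1) <= b; for 0 <= a the
   bound e^t <= 1 is enough. *)
have [a0|a0] := ltP a 0; first by have := @ltr_nM2l _ a a0 (expR (a - b)) (1 + (a - b)); nra.
have : expR (a - b) <= 1 by rewrite expR_le1; lra.
nra.
Qed.

Lemma mul_expR_gt (R : realType) (a b : R) : b <= -1 -> a < b ->
  b * expR b < a * expR a.
Proof.
move=> b1 ab; have t0 : b - a != 0 by lra.
suff h : b * expR (b - a) < a.
  have -> : expR b = expR (b - a) * expR a by rewrite -expRD subrK.
  by rewrite mulrA ltr_pM2r ?expR_gt0.
(* With t = b - a and b < 0: b e^t < b (1 + t) = a + (b - a)(b + 1) <= a. *)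
have e1 := expR_gt1Dx t0; nra.
Qed.

Lemma mul_expR_ge (R : realType) (a : R) : - (expR 1)^-1 <= a * expR a.
Proof.
have -> : - (expR 1)^-1 = -1 * expR (-1) :> R by rewrite expRN mulN1r.
have [a1|a1|->//] := ltgtP a (-1).
  by rewrite ltW// mul_expR_gt.
by rewrite ltW// mul_expR_lt.
Qed.

(** [get] yields a point of the defining set once that set is inhabited, here by [w]; strict
    monotonicity from -1 upwards makes it [w] itself. *)
Lemma lambertW_mul_expR (R : realType) (w : R) : -1 <= w ->
  lambertW (w * expR w) = w.
Proof.
move=> w1; rewrite /lambertW.
have [] : [set v : R | -1 <= v /\ v * expR v = w * expR w]%classic
    (get [set v : R | -1 <= v /\ v * expR v = w * expR w]%classic).
  by apply: (@getI _ _ w).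
set v := get _ => v1 vw; have [vlt|vgt|//] := ltgtP v w.
  by have := mul_expR_lt R _ _ v1 vlt; rewrite vw ltxx.
by have := mul_expR_lt R _ _ w1 vgt; rewrite vw ltxx.
Qed.

Lemma lambertWm1_mul_expR (R : realType) (w : R) : w <= -1 ->
  lambertWm1 (w * expR w) = w.
Proof.
move=> w1; rewrite /lambertWm1.
have [] : [set v : R | v <= -1 /\ v * expR v = w * expR w]%classic
    (get [set v : R | v <= -1 /\ v * expR v = w * expR w]%classic).
  by apply: (@getI _ _ w).
set v := get _ => v1 vw; have [vlt|vgt|//] := ltgtP v w.
  by have := mul_expR_gt R _ _ w1 vlt; rewrite vw ltxx.
by have := mul_expR_gt R _ _ v1 vgt; rewrite vw ltxx.
Qed.

(** * Rational bounds for logarithms from ln ((1 + y)/(1 - y)) = 2 artanh y *)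

Definition atanh_sum (R : realType) (n : nat) (y : R) : R :=
  \sum_(i < n) y ^+ (2 * i).+1 / (2 * i).+1%:R.

Lemma is_derive_expn_div (R : realType) (m : nat) (x : R) :
  is_derive x 1 (fun y : R => y ^+ m.+1 / m.+1%:R) (x ^+ m).
Proof.
have -> : (fun y : R => y ^+ m.+1 / m.+1%:R) = m.+1%:R^-1 \*: ((@id R) ^+ m.+1).
  by apply/funext => y; rewrite /= exprfctE mulrC.
apply: is_derive_eq.
by rewrite /= /GRing.scale /= mulr1 mulrA mulVf ?mul1r// pnatr_eq0.
Qed.

Lemma is_derive_atanh_sum (R : realType) (n : nat) (x : R) : x ^+ 2 != 1 ->
  is_derive x 1 (atanh_sum R n) ((1 - x ^+ (2 * n)) / (1 - x ^+ 2)).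
Proof.
move=> x1; have x1' : 1 - x ^+ 2 != 0 by rewrite subr_eq0 eq_sym.
elim: n => [|n IH].
  rewrite muln0 expr0 subrr mul0r (_ : atanh_sum R 0 = cst 0); first exact: is_derive_cst.
  by apply/funext => y; rewrite /atanh_sum big_ord0.
have -> : atanh_sum R n.+1 = atanh_sum R n + (fun y => y ^+ (2 * n).+1 / (2 * n).+1%:R).
  by apply/funext => y; rewrite /atanh_sum big_ord_recr.
have D := is_derive_expn_div R (2 * n) x.
apply: is_derive_eq; rewrite mulnS exprD.
by field.
Qed.

Lemma ge0_of_ge0_derive (R : realType) (f df : R -> R) (y : R) : 0 <= y ->
  0 <= f 0 -> (forall x, 0 <= x <= y -> is_derive x 1 f (df x)) ->
  (forall x, 0 <= x <= y -> 0 <= df x) -> 0 <= f y.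
Proof.
move=> y0 f0 fd fp.
have fc : {within `[0, y]%classic, continuous f}%classic.
  apply: derivable_within_continuous => x; rewrite in_itv => /= hx.
  by apply: ex_derive; exact: fd.
have fd' x : x \in `]0, y[%R -> is_derive x 1 f (df x).
  by rewrite in_itv/= => /andP[a b]; apply: fd; rewrite !ltW.
have [c + E] := MVT_segment y0 fd' fc; rewrite in_itv/= => hc.
have : 0 <= f y - f 0 by rewrite E mulr_ge0 ?fp// subr0.
lra.
Qed.

Lemma is_derive_ln_ratio (R : realType) (x : R) : -1 < x < 1 ->
  is_derive x 1 (fun y : R => ln (1 + y) - ln (1 - y)) (2 / (1 - x ^+ 2)).
Proof.
move=> /andP[x0 x1].
have x2' : 1 - x ^+ 2 != 0 by rewrite expr2; nra.
have Dp : is_derive x 1 (fun y : R => 1 + y) 1.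
  by have := is_derive_shift x 1 (1 : R); rewrite /shift; under eq_fun do rewrite addrC.
have Dm : is_derive x 1 (fun y : R => 1 - y) (-1).
  have -> : (fun y : R => 1 - y) = cst 1 - id by [].
  by apply: is_derive_eq; rewrite sub0r.
have Lp : is_derive x 1 (@ln R \o (fun y => 1 + y)) ((1 + x)^-1 * 1).
  by apply: is_derive1_comp; apply: is_derive1_ln; lra.
have Lm : is_derive x 1 (@ln R \o (fun y => 1 - y)) ((1 - x)^-1 * -1).
  by apply: is_derive1_comp; apply: is_derive1_ln; lra.
have := is_deriveB Lp Lm.
move/is_derive_eq; apply; field; nra.
Qed.

(** The two sides agree at 0, and their difference has derivative 2 x^(2n)/(1 - x^2) >= 0, a
    geometric tail. *)
Lemma ln_atanh_sum_lower (R : realType) (n : nat) (y : R) : 0 <= y < 1 ->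
  2 * atanh_sum R n y <= ln ((1 + y) / (1 - y)).
Proof.
move=> /andP[y0 y1].
rewrite ln_div ?posrE; [|lra|lra].
rewrite -subr_ge0.
apply: (@ge0_of_ge0_derive R (fun y => ln (1 + y) - ln (1 - y) - 2 * atanh_sum R n y)
  (fun y => 2 * y ^+ (2 * n) / (1 - y ^+ 2))) => //.
- rewrite addr0 subr0 subrr /atanh_sum big1 ?mulr0 ?subr0// => i _.
  by rewrite expr0n mul0r.
- move=> x /andP[x0 xy].
  have x2 : x ^+ 2 != 1 by rewrite expr2; nra.
  have D := is_derive_atanh_sum R n x x2.
  have Dln : is_derive x 1 (fun y => ln (1 + y) - ln (1 - y)) (2 / (1 - x ^+ 2)).
    by apply: is_derive_ln_ratio; lra.
  have := is_deriveB Dln (is_deriveZ 2 D).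
  move/is_derive_eq; apply.
  rewrite /GRing.scale /=; field; nra.
- move=> x /andP[x0 xy]; rewrite divr_ge0 ?mulr_ge0 ?exprn_ge0// expr2; nra.
Qed.

(** The correction dominates the tail of the series by a geometric series of ratio y^2. Its
    derivative is x^(2n)/(1 - x^2), which completes the truncated geometric sum, plus a nonnegative
    term. *)
Lemma ln_atanh_sum_upper (R : realType) (n : nat) (y : R) : 0 <= y < 1 ->
  ln ((1 + y) / (1 - y)) <=
    2 * (atanh_sum R n y + y ^+ (2 * n).+1 / (2 * n).+1%:R / (1 - y ^+ 2)).
Proof.
move=> /andP[y0 y1].
rewrite ln_div ?posrE; [|lra|lra].
rewrite -subr_ge0.
pose r (y : R) := y ^+ (2 * n).+1 / (2 * n).+1%:R.
apply: (@ge0_of_ge0_derive R (fun y => 2 * (atanh_sum R n y + r y / (1 - y ^+ 2)) -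
    (ln (1 + y) - ln (1 - y)))
  (fun y => 4 * y * r y / (1 - y ^+ 2) ^+ 2)) => //.
- rewrite addr0 subr0 subrr /r exprS !mul0r addr0 /atanh_sum big1 ?mulr0 ?subr0//.
  by move=> i _; rewrite expr0n mul0r.
- move=> x /andP[x0 xy].
  have x2 : x ^+ 2 != 1 by rewrite expr2; nra.
  have x2' : 1 - x ^+ 2 != 0 by rewrite subr_eq0 eq_sym.
  have Dln : is_derive x 1 (fun y => ln (1 + y) - ln (1 - y)) (2 / (1 - x ^+ 2)).
    by apply: is_derive_ln_ratio; lra.
  have D := is_derive_atanh_sum R n x x2.
  have Dr := is_derive_expn_div R (2 * n) x.
  have Di : is_derive x 1 (fun y : R => (1 - y ^+ 2)^-1) (2 * x / (1 - x ^+ 2) ^+ 2).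
    have Dq : is_derive x 1 (fun y : R => 1 - y ^+ 2) (- (2 * x)).
      have -> : (fun y : R => 1 - y ^+ 2) = cst 1 - (@id R) ^+ 2.
        by apply/funext => y'; rewrite fctE /= exprfctE.
      by apply: is_derive_eq; rewrite /GRing.scale /= sub0r mulr1 expr1.
    have := @is_deriveV R (fun y => 1 - y ^+ 2) x _ 1 x2' Dq; move/is_derive_eq; apply.
    by rewrite /GRing.scale /=; field.
  have := is_deriveB (is_deriveZ 2 (is_deriveD D (is_deriveM Dr Di))) Dln.
  move/is_derive_eq; apply.
  have n0 : (0 : R) <= n%:R by [].
  by rewrite /GRing.scale /= /r exprS; field; rewrite -expr2 x2' lt0r_neq0//; lra.
- move=> x /andP[x0 xy].
  have r0 : 0 <= r x by rewrite /r divr_ge0// exprn_ge0.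
  by rewrite divr_ge0 ?sqr_ge0// mulr_ge0// mulr_ge0.
Qed.

Lemma atanh_sum9 (R : realType) (y : R) : atanh_sum R 9 y =
  y + y ^+ 3 / 3 + y ^+ 5 / 5 + y ^+ 7 / 7 + y ^+ 9 / 9 + y ^+ 11 / 11 +
  y ^+ 13 / 13 + y ^+ 15 / 15 + y ^+ 17 / 17.
Proof. by rewrite /atanh_sum !big_ord_recr big_ord0 /= add0r expr1 divr1. Qed.

Lemma ln_bounds9 (R : realType) (y : R) : 0 <= y < 1 ->
  2 * atanh_sum R 9 y <= ln ((1 + y) / (1 - y)) <=
    2 * (atanh_sum R 9 y + y ^+ 19 / 19 / (1 - y ^+ 2)).
Proof.
by move=> y01; rewrite ln_atanh_sum_lower//; exact: (ln_atanh_sum_upper R 9).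
Qed.

Lemma ln2_bounds (R : realType) :
  693 / 10 ^+ 3 + 147 / 10 ^+ 6 + 180 / 10 ^+ 9 <= ln (2 : R) <=
    693 / 10 ^+ 3 + 147 / 10 ^+ 6 + 181 / 10 ^+ 9.
Proof.
have y : 0 <= (1 / 3 : R) < 1 by apply/andP; split; lra.
have E : (1 + 1 / 3) / (1 - 1 / 3) = 2 :> R by field.
have := ln_bounds9 R _ y.
have -> : (1 - (1 / 3) ^+ 2)^-1 = 9 / 8 :> R by field.
rewrite E atanh_sum9 => /andP[l u].
apply/andP; split.
 lra.
lra.
Qed.

(* 531/1322 and 676/1683 are the fractions of least denominator on either side of
   the attracting fixed point inside the required error window. *)
Lemma ln_gt_at_531_1322 (R : realType) :
  (1 / 7 + 6 / 7 * (531 / 1322)) * ln 2 < ln (1 + 531 / 1322) :> R.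
Proof.
(* The argument is x/(2 + x) for x = [531 / 1322], the solution of (1 + y)/(1 - y) = 1 + x. *)
have y : 0 <= (531 / 3175 : R) < 1 by apply/andP; split; lra.
have E : (1 + 531 / 3175) / (1 - 531 / 3175) = 1 + 531 / 1322 :> R by field.
have /andP[+ _] := ln_bounds9 R _ y; rewrite E atanh_sum9.
have /andP[_] := ln2_bounds R.
lra.
Qed.

Lemma ln_lt_at_676_1683 (R : realType) :
  ln (1 + 676 / 1683) < (1 / 7 + 6 / 7 * (676 / 1683)) * ln 2 :> R.
Proof.
have y : 0 <= (338 / 2021 : R) < 1 by apply/andP; split; lra.
have E : (1 + 338 / 2021) / (1 - 338 / 2021) = 1 + 676 / 1683 :> R by field.
have /andP[_ +] := ln_bounds9 R _ y; rewrite E atanh_sum9.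
have -> : (1 - (338 / 2021) ^+ 2)^-1 = 2021 / 1683 * (2021 / 2359) :> R by field.
have /andP[+ _] := ln2_bounds R.
lra.
Qed.

(** * The fixed point equation as a Lambert equation *)

Lemma powR2E (R : realType) (t : R) : 2 `^ t = expR (t * ln 2).
Proof. by rewrite /powR pnatr_eq0. Qed.

Lemma cexpD (R : realType) (a b : R[i]) : cexp (a + b) = cexp a * cexp b.
Proof.
case: a b => [a1 a2] [b1 b2]; rewrite /cexp /= expRD cosD sinD.
by apply/eqP; rewrite eq_complex /=; apply/andP; split; apply/eqP; ring.
Qed.

Lemma cexp_real (R : realType) (x : R) : cexp x%:C = (expR x)%:C.
Proof. by rewrite /cexp /= cos0 sin0 mulr1 mulr0. Qed.

Lemma cexp_mulVN (R : realType) (a : R[i]) : cexp a * cexp (- a) = 1.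
Proof. by rewrite -cexpD subrr (cexp_real R 0) expR0. Qed.

Lemma ln2_gt0 (R : realType) : 0 < ln (2 : R).
Proof. by rewrite ln_gt0// ltr1n. Qed.

(** Since 1/7 + 6/7 z = 6/7 (1 + z) - 5/7, one has [psiC z] + 1 = e^(-w) 2^(-5/7). A fixed point
    thus means (1 + z) e^w = 2^(-5/7), to be multiplied by the nonzero number -6/7 log 2. *)
Lemma psiC_fixed_iff (R : realType) (z : R[i]) :
  psiC z = z <->
  let w := - (6 / 7) * (1 + z) * (ln 2)%:C in
  w * cexp w = (- (6 / 7) * 2 `^ (- (5 / 7)) * ln 2)%:C.
Proof.
move=> /=; set L := (ln (2 : R))%:C; set w := - (6 / 7) * (1 + z) * L.
have wE : w = - (6 / 7) * (1 + z) * L by [].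
have L0 : L != 0 by rewrite (inj_eq (@complexI R)) gt_eqF// ln2_gt0.
pose q : R := 2 `^ (- (5 / 7)).
have -> : (- (6 / 7) * 2 `^ (- (5 / 7)) * ln 2)%:C = - (6 / 7) * q%:C * L.
  by rewrite !(rmorphM, rmorphN, fmorphV, rmorph_nat).
have E : psiC z = cexp (- w) * q%:C - 1.
  rewrite /psiC /cpow /q powR2E -cexp_real -cexpD; congr (cexp _ - 1).
  rewrite !(rmorphM, rmorphN, fmorphV, rmorph_nat) -/L /w.
  by field.
have W := cexp_mulVN R w.
rewrite E; split => h.
  have h1 : 1 + z = cexp (- w) * q%:C by rewrite -[in LHS]h; ring.
  rewrite [X in X * _ = _]wE h1.
  have -> : - (6 / 7) * (cexp (- w) * q%:C) * L * cexp w =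
      cexp w * cexp (- w) * (- (6 / 7) * q%:C * L) by ring.
  by rewrite W mul1r.
have k0 : - (6 / 7) * L != 0.
  by rewrite mulf_neq0// oppr_eq0 mulf_neq0 ?invr_eq0 ?pnatr_eq0.
have -> : q%:C = (1 + z) * cexp w.
  apply: (mulfI k0); transitivity (w * cexp w); first by rewrite h; ring.
  by rewrite [X in X * _ = _]wE; ring.
rewrite mulrCA [cexp (- w) * _]mulrC W; ring.
Qed.

Lemma lambert_argE (R : realType) :
  lambert_arg R = - (6 / 7) * 2 `^ (- (5 / 7)) * ln 2.
Proof.
rewrite /lambert_arg !powR2E.
have -> : 2 / 7 * ln 2 = ln 2 + - (5 / 7) * ln (2 : R) by field.
by rewrite expRD lnK ?posrE//; field.
Qed.

Lemma psi_fixed_iff (R : realType) (x : R) : psi x = x <->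
  let w := - (6 / 7) * (1 + x) * ln 2 in w * expR w = lambert_arg R.
Proof.
have := psiC_fixed_iff R x%:C; cbv zeta; rewrite psiC_real -lambert_argE.
have -> : - (6 / 7) * (1 + x%:C) * (ln 2)%:C = (- (6 / 7) * (1 + x) * ln 2)%:C :> R[i].
  by rewrite !(rmorphM, rmorphD, rmorphN, fmorphV, rmorph_nat, rmorph1).
rewrite cexp_real -rmorphM => -[h1 h2].
by split => [h|h]; apply: complexI; [apply: h1|apply: h2]; rewrite h.
Qed.

(** Both sides are -6/7 log 2 times an exponential, so comparing them means comparing exponents in
    reverse order. The sign conditions of the intermediate value theorem become inequalities between
    logarithms. *)
Lemma mul_expR_lambert_arg (R : realType) (x : R) : -1 < x ->
  let w := - (6 / 7) * (1 + x) * ln 2 in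
  (w * expR w < lambert_arg R) = ((1 / 7 + 6 / 7 * x) * ln 2 < ln (1 + x)) /\
  (lambert_arg R < w * expR w) = (ln (1 + x) < (1 / 7 + 6 / 7 * x) * ln 2).
Proof.
move=> x1 w; have L0 := ln2_gt0 R.
have x0 : 1 + x \is Num.pos by rewrite posrE; lra.
have k0 : - (6 / 7) * ln 2 < 0 :> R by nra.
have -> : w * expR w = - (6 / 7) * ln 2 * expR (ln (1 + x) + w).
  by rewrite expRD lnK// /w; ring.
have -> : lambert_arg R = - (6 / 7) * ln 2 * expR (- (5 / 7) * ln 2).
  by rewrite lambert_argE powR2E; ring.
have -> : (1 / 7 + 6 / 7 * x) * ln 2 = - (5 / 7) * ln 2 - w by rewrite /w; field.
by rewrite !(ltr_nM2l k0) !ltr_expR ltrBlDr ltrBrDr.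
Qed.

Lemma lambertW_arg_bounds (R : realType) :
  let w := lambertW (lambert_arg R) in
  w * expR w = lambert_arg R /\
  - (6 / 7) * (1 + 531 / 1322) * ln 2 <= w <= - (6 / 7) * (1 + 676 / 1683) * ln 2.
Proof.
move=> /=; have /andP[l1 l2] := ln2_bounds R.
set a := - (6 / 7) * _ * ln 2; set b := - (6 / 7) * _ * ln 2.
have [ha _] := mul_expR_lambert_arg R (531 / 1322) ltac:(lra).
have [_ hb] := mul_expR_lambert_arg R (676 / 1683) ltac:(lra).
rewrite ln_gt_at_531_1322 -/a in ha; rewrite ln_lt_at_676_1683 -/b in hb.
have ab : a <= b by rewrite /a /b; nra.
(* This puts the root found in [a, b] on the principal branch. *)
have a1 : -1 <= a by rewrite /a; lra.
have gc : {within `[a, b]%classic, continuous (fun w : R => w * expR w)}%classic.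
  apply: continuous_subspaceT => x.
  by apply: cvgM; [exact: cvg_id|exact: continuous_expR].
have [w /andP[aw wb] <-] : exists2 w, w \in `[a, b] & w * expR w = lambert_arg R.
  by apply: IVT => //; rewrite ge_min le_max (ltW ha) (ltW hb) orbT.
rewrite !bnd_simp in aw wb.
by rewrite lambertW_mul_expR ?aw ?wb// (le_trans a1).
Qed.

(** Written through [psi x] so that at a fixed point the derivative is -w, with w the Lambert
    variable. *)
Lemma is_derive_psi (R : realType) (x : R) :
  is_derive x 1 (@psi R) (6 / 7 * ln 2 * (1 + psi x)).
Proof.
pose l (y : R) := (1 / 7 + 6 / 7 * y) * ln 2.
have -> : @psi R = (expR \o l) - cst 1.
  by apply/funext => y; rewrite /psi powR2E.
have Dl : is_derive x 1 l (6 / 7 * ln 2).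
  have -> : l = cst (1 / 7 * ln 2) + (6 / 7 * ln 2) \*: id.
    by apply/funext => y; rewrite /l fctE /= /GRing.scale /=; ring.
  by apply: is_derive_eq; rewrite /GRing.scale /= add0r mulr1.
have D := is_derive1_comp (is_derive_expR (l x)) Dl.
have := is_deriveB D (is_derive_cst (1 : R) x 1); move/is_derive_eq; apply.
by rewrite /= !fctE /=; ring.
Qed.

(** * Elements of order 7 and their conjugacy *)

Section FrobeniusGroup21.
Variables (gT : finGroupType) (G C7 C3 : {group gT}).
Hypotheses (hC7card : #|C7| = 7%N) (hC3card : #|C3| = 3%N).
Hypotheses (hG : (C7 ><| C3)%g = G) (hact : ~~ (C3 \subset 'C(C7))%g).
Local Open Scope group_scope.
Local Open Scope nat_scope.

Lemma card_G21 : #|G| = 21.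
Proof. by rewrite -(sdprod_card hG) hC7card hC3card. Qed.

(** [C7] is a normal Hall 7-subgroup, so it contains every element of order 7. *)
Lemma order7_cycle (a : gT) : a \in G -> #[a] = 7 -> <[a]> = C7 :> {set gT}.
Proof.
move=> aG a7; have [nC7 sC3 _ _ _] := sdprod_context hG.
have hallC7 : 7.-Hall(G) C7.
  rewrite /pHall normal_sub//= -divgS ?normal_sub// card_G21 hC7card.
  by rewrite /pgroup hC7card pnat_id//= p'natE.
have aC7 : a \in C7 by rewrite (mem_normal_Hall hallC7 nC7)// /p_elt a7.
by apply/eqP; rewrite eqEcard cycle_subG aC7 hC7card -orderE a7.
Qed.

(** Some y in [C3] does not centralise [C7], so a^y is the i-th power of a with i^3 = 1 and i != 1
    modulo 7. Hence i is 2 or 4, and for i = 4 the element y^2 acts by 16 = 2. *)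
Lemma order7_conj_sqr (a : gT) : a \in G -> #[a] = 7 ->
  exists2 y, y \in G & (a ^ y = a ^+ 2)%g.
Proof.
move=> aG a7; have aC := order7_cycle _ aG a7.
have [nC7 sC3 _ nC73 _] := sdprod_context hG.
have /fintype.subsetPn[y yC3 yC7] := hact.
have yG := fintype.subsetP sC3 _ yC3.
have : (a ^ y)%g \in <[a]>%g.
  by rewrite aC memJ_norm ?(fintype.subsetP nC73)// -aC cycle_id.
case/cycleP => i0; rewrite -expg_mod_order a7; set i := (i0 %% 7) => ai.
have i7 : i < 7 by rewrite ltn_mod.
have y3 : (y ^+ 3 = 1)%g by apply/eqP; rewrite -order_dvdn -hC3card order_dvdG.
have aE k : (a ^ (y ^+ k) = a ^+ (i ^ k))%g.
  elim: k => [|k IH]; first by rewrite expg0 conjg1 expn0 expg1.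
  by rewrite expgSr conjgM IH conjXg ai -expgM mulnC -expnSr.
have : (a ^+ (i ^ 3) == a ^+ 1)%g by rewrite -aE y3 conjg1 expg1.
rewrite eq_expg_mod_order a7.
have : i != 1.
  apply: contraNneq yC7 => i1; rewrite -aC cent_cycle cent1C.
  by apply/cent1P/commgP/conjg_fixP; rewrite ai i1 expg1.
move: i7 ai aE; case: i => [|[|[|[|[|[|[|]]]]]]]// _ ai aE _ _.
  by exists y.
exists (y ^+ 2)%g; first by rewrite groupX.
by rewrite aE -expg_mod_order a7.
Qed.

(** The only other order possible is 21, which would make [G] cyclic, hence abelian, against
    [hact]. *)
Lemma not_dvd7_order (a : gT) : a \in G -> #[a] != 7 -> ~~ (7 %| #[a]).
Proof.
move=> aG a7; apply/negP => d7.
have := order_dvdG aG; rewrite card_G21 => d21.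
have : #[a] = 21.
  move: d7 => /dvdnP[k kE]; move: d21 a7; rewrite kE.
  rewrite -[21]/(3 * 7) dvdn_pmul2r// => k3 k7.
  have k1 : k != 1 by apply: contraNneq k7 => ->.
  by rewrite (prime_nt_dvdP _ k1 k3).
move=> a21; case/negP: hact.
have aG' : <[a]>%g = G :> {set gT}.
  by apply/eqP; rewrite eqEcard cycle_subG aG card_G21 -orderE a21.
have [nC7 sC3 _ _ _] := sdprod_context hG.
have := cycle_abelian a; rewrite aG' => abG.
exact: (fintype.subset_trans sC3 (fintype.subset_trans abG (centS (normal_sub nC7)))).
Qed.

Section ClassFunctions.
Variables (T : Type) (u : gT -> T).
Hypothesis uG : is_classfun G u.

Lemma classfun_sqr7 (a : gT) : a \in G -> #[a] = 7 -> u (a ^+ 2)%g = u a.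
Proof. by move=> aG a7; have [y yG <-] := order7_conj_sqr _ aG a7; rewrite uG. Qed.

(** The class of [a] contains its powers 1, 2, 4, so [b] is one of the powers 3, 5, 6, which
    squaring permutes cyclically. *)
Lemma classfun_pow7 (a b : gT) : a \in G -> b \in G -> #[a] = 7 -> #[b] = 7 ->
  b \notin (a ^: G)%g ->
  [/\ u (a ^+ 2)%g = u a, u (a ^+ 4)%g = u a, u (a ^+ 3)%g = u b,
      u (a ^+ 5)%g = u b & u (a ^+ 6)%g = u b].
Proof.
move=> aG bG a7 b7 bna.
have o i : 0 < i < 7 -> #[(a ^+ i)%g] = 7.
  case/andP=> i0 i7; rewrite orderXgcd a7.
  by move: i i0 i7; do 7! case=> //.
have sq i : 0 < i < 7 -> u (a ^+ (i * 2 %% 7))%g = u (a ^+ i)%g.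
  move=> hi; rewrite -a7 expg_mod_order expgM; apply: classfun_sqr7; last exact: o.
  by rewrite groupX.
have s1 : u (a ^+ 2)%g = u a by have := sq 1 isT; rewrite expg1.
have s2 : u (a ^+ 4)%g = u (a ^+ 2)%g := sq 2 isT.
have s3 : u (a ^+ 6)%g = u (a ^+ 3)%g := sq 3 isT.
have s5 : u (a ^+ 3)%g = u (a ^+ 5)%g := sq 5 isT.
have : b \in <[a]>%g by rewrite (order7_cycle _ aG a7) -(order7_cycle _ bG b7) cycle_id.
case/cycleP=> t0; rewrite -expg_mod_order a7; set t := (t0 %% 7) => bE.
have t7 : t < 7 by rewrite ltn_mod.
have [y yG ay] := order7_conj_sqr _ aG a7.
have c2 : (a ^+ 2)%g \in (a ^: G)%g by rewrite -ay memJ_class.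
have c4 : (a ^+ 4)%g \in (a ^: G)%g.
  have -> : (a ^+ 4 = a ^ (y * y))%g by rewrite conjgM ay conjXg ay -expgM.
  by rewrite memJ_class// groupM.
have : [|| t == 3, t == 5 | t == 6].
  move: bna b7; rewrite bE; move: t7; case: t {bE} => [|[|[|[|[|[|[|]]]]]]]//.
  - by rewrite expg0 order1.
  - by rewrite expg1 class_refl.
  - by rewrite c2.
  - by rewrite c4.
by case/or3P => /eqP tE; rewrite tE in bE; rewrite bE; split; congruence.
Qed.

End ClassFunctions.
End FrobeniusGroup21.

(** * The wedge operation on class functions of [G] *)

Lemma Psi_order7 (R : realType) (gT : finGroupType) (G C7 C3 : {group gT}) :
  #|C7| = 7%N -> #|C3| = 3%N -> (C7 ><| C3)%g = G ->
  ~~ (C3 \subset 'C(C7))%g ->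
  forall (u : gT -> R[i]) (a b : gT), is_classfun G u -> u 1%g = 1 ->
    a \in G -> b \in G -> #[a]%g = 7%N -> #[b]%g = 7%N -> b \notin (a ^: G)%g ->
  Psi G u a = cpow 2 (1 / 7 + 3 / 7 * (u a + u b)) - 1.
Proof.
move=> hC7 hC3 hG hact u a b uG u1 aG bG a7 b7 bna.
have [u2 u4 u3 u5 u6] :=
  classfun_pow7 _ _ _ _ hC7 hC3 hG hact _ _ uG _ _ aG bG a7 b7 bna.
rewrite /Psi /wedge /cpow (card_G21 _ _ _ _ hC7 hC3 hG).
rewrite (sum_wedge_coef21 R (fun j => u (a ^+ j)%g) (u a) (u b))//.
by move=> j; rewrite expgD -a7 expg_order mulg1.
Qed.

(** The coefficients sum to log 2. This gives the fixed point identity 2 = 1 + 1 away from the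
    elements of order 7. *)
Lemma wedge_one_on_powers (R : realType) (gT : finGroupType) (G : {group gT})
    (f : gT -> R[i]) (g : gT) : #|G| = 21%N -> (forall j, f (g ^+ j)%g = 1) ->
  wedge G f g = 2.
Proof.
move=> G21 f1; rewrite /wedge G21 (sum_wedge_coef21 R (fun j => f (g ^+ j)%g) 1 1)//.
  have -> : 1 / 7 + 3 / 7 * (1 + 1) = 1 :> R[i] by field.
  by rewrite mul1r cexp_real lnK ?posrE// rmorph_nat.
by move=> j; rewrite !f1.
Qed.

Lemma linear_character_sqr (R : realType) (gT : finGroupType) (G : {group gT})
    (f : gT -> R[i]) (g : gT) : is_linear_character G f -> g \in G ->
  f (g ^+ 2)%g = f g ^+ 2.
Proof.
move=> [rG fE] gG; rewrite !fE ?groupX// repr_mxM// [rG g]mx11_scalar.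
by rewrite -scalar_mxM !mxtrace_scalar mulr1n expr2.
Qed.

(** * The two real fixed points and their stability *)

Lemma fixed_points_psi (R : realType) :
  (forall x : R, psi x = x <-> x = 1 \/ x = z0 R) /\
   z0 R <> 1 /\
   - (expR 1)^-1 <= lambert_arg R < 0 /\
   - (6 / 7) * (1 + 1) * ln 2 = lambertWm1 (lambert_arg R) /\
   - (6 / 7) * (1 + z0 R) * ln 2 = lambertW (lambert_arg R) /\
   `|z0 R - (401 / 10 ^+ 3 + 664 / 10 ^+ 6)| < 5 / 10 ^+ 7 /\
   repulsive (@psi R) 1 /\
   derive1 (@psi R) 1 = 12 * ln 2 / 7 /\
   (12 * ln 2 / 7 > 1 :> R) /\
   attracting (@psi R) (z0 R).
Proof.
have L0 := ln2_gt0 R; have /andP[L1 L2] := ln2_bounds R.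
have [w0E /andP[wa wb]] := lambertW_arg_bounds R.
set w0 := lambertW _ in w0E wa wb *.
have z0E : - (6 / 7) * (1 + z0 R) * ln 2 = w0.
  by rewrite /z0 -/w0; field; lra.
have psi1 : psi (1 : R) = 1.
  rewrite /psi (_ : 1 / 7 + 6 / 7 * 1 = 1); last by field.
  by rewrite powRr1//; ring.
pose w1 : R := - (6 / 7) * (1 + 1) * ln 2.
have w1E : w1 * expR w1 = lambert_arg R by apply/(psi_fixed_iff R 1).
have w11 : w1 < -1 by rewrite /w1; lra.
(* Passing from w to z divides by -6/7 log 2 < 0, which swaps the two bounds. *)
have zlo : 676 / 1683 <= z0 R by rewrite -(ler_nM2l (_ : - (6 / 7) * ln 2 < 0)); nra.
have zhi : z0 R <= 531 / 1322 by rewrite -(ler_nM2l (_ : - (6 / 7) * ln 2 < 0)); nra.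
have w0m1 : -1 < w0 by lra.
have w0lt0 : w0 < 0 by clear -L0 wb; lra.
have psiz0 : psi (z0 R) = z0 R by apply/psi_fixed_iff; rewrite /= z0E.
have d1 : derive1 (@psi R) 1 = 12 * ln 2 / 7.
  by rewrite derive1E (@derive_val _ _ _ _ _ _ _ (is_derive_psi R 1)) psi1; field.
have dz : derive1 (@psi R) (z0 R) = - w0.
  rewrite derive1E (@derive_val _ _ _ _ _ _ _ (is_derive_psi R (z0 R))) psiz0 -z0E.
  by ring.
have dv x : derivable (@psi R) x 1 by have D := is_derive_psi R x; exact: ex_derive.
have gt1 : 12 * ln 2 / 7 > 1 :> R by clear -L1; lra.
split; last split; last split; last split; last split; last split; last split;
  last split; last split.
- move=> x; split=> [/psi_fixed_iff /=|[->|->]//].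
  set w := - (6 / 7) * (1 + x) * ln 2 => wE.
  have inj v : w = - (6 / 7) * (1 + v) * ln 2 -> x = v.
    have k0 : - (6 / 7) != 0 :> R by rewrite lt_eqF//; lra.
    by rewrite /w => /(mulIf (lt0r_neq0 L0)) /(mulfI k0) /addrI.
  (* The position of w relative to -1 decides the branch; the Lambert equation then forces w = [w1]
     or w = [w0]. *)
  have [wle|wgt] := leP w (-1).
    left; apply: inj; rewrite -/w1 -(lambertWm1_mul_expR R _ wle) wE -w1E.
    by rewrite lambertWm1_mul_expR// ltW.
  right; apply: inj; rewrite z0E -(lambertW_mul_expR R _ (ltW wgt)) wE -w0E.
  by rewrite lambertW_mul_expR// ltW.
- by clear -zhi; lra.
- by rewrite -{1}w1E mul_expR_ge -w0E pmulr_llt0 ?expR_gt0.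
- by rewrite -w1E lambertWm1_mul_expR// ltW.
- exact: z0E.
- by clear -zlo zhi; rewrite ltr_norml; apply/andP; split; lra.
- by split; [|exact: dv|by rewrite d1 gtr0_norm// (lt_trans ltr01)].
- exact: d1.
- exact: gt1.
- split; [by []|exact: dv|].
  by rewrite dz normrN ltr_norml; clear -w0m1 w0lt0; apply/andP; split; lra.
Qed.

(** * Assembly over the two classes of elements of order 7 *)

Theorem mainTheorem4 (R : realType) (gT : finGroupType)
    (G C7 C3 : {group gT})
    (hC7 : cyclic C7) (hC7card : #|C7| = 7%N)
    (hC3 : cyclic C3) (hC3card : #|C3| = 3%N)
    (hG : (C7 ><| C3)%g = G)
    (hact : ~~ (C3 \subset 'C(C7))%g)
    (c7A c7B : {set gT})
    (h7A : c7A \in classes G) (h7B : c7B \in classes G)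
    (h7AB : c7A != c7B)
    (h7Aord : forall g, g \in c7A -> #[g]%g = 7%N)
    (h7Bord : forall g, g \in c7B -> #[g]%g = 7%N) :
  (* (a) *)
  ((forall u : gT -> R[i], is_classfun G u -> u 1%g = 1 ->
      forall a b, a \in c7A -> b \in c7B ->
        Psi G u a = cpow 2 (1 / 7 + 3 / 7 * (u a + u b)) - 1 /\
        Psi G u b = cpow 2 (1 / 7 + 3 / 7 * (u a + u b)) - 1) /\
   (forall (u : gT -> R[i]) (z : R[i]), is_classfun G u -> u 1%g = 1 ->
      (forall g, g \in c7A :|: c7B -> u g = z) ->
      forall g, g \in c7A :|: c7B -> Psi G u g = psiC z)) /\
  (* (b) *)
  (forall z : R[i],
     psiC z = z <->
     let w := - (6 / 7) * (1 + z) * (ln 2)%:C in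
     w * cexp w = (- (6 / 7) * 2 `^ (- (5 / 7)) * ln 2)%:C) /\
  (* (c) *)
  ((forall x : R, psi x = x <-> x = 1 \/ x = z0 R) /\
   z0 R <> 1 /\
   - (expR 1)^-1 <= lambert_arg R < 0 /\
   - (6 / 7) * (1 + 1) * ln 2 = lambertWm1 (lambert_arg R) /\
   - (6 / 7) * (1 + z0 R) * ln 2 = lambertW (lambert_arg R) /\
   `|z0 R - (401 / 10 ^+ 3 + 664 / 10 ^+ 6)| < 5 / 10 ^+ 7 /\
   repulsive (@psi R) 1 /\
   derive1 (@psi R) 1 = 12 * ln 2 / 7 /\
   (12 * ln 2 / 7 > 1 :> R) /\
   attracting (@psi R) (z0 R)) /\
  (* (d) *)
  (exists f : gT -> R[i],
     is_classfun G f /\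
     (forall g, g \in c7A :|: c7B -> f g = (z0 R)%:C) /\
     (forall g, g \in G -> wedge G f g = 1 + f g) /\
     (forall g, g \in G -> f (g^-1)%g = conjc (f g)) /\
     f 1%g = 1 /\
     ~ is_linear_character G f).
Proof.
have inG (c : {set gT}) g : c \in classes G -> g \in c -> g \in G.
  by case/imsetP => x xG -> ; apply/fintype.subsetP/class_subG.
have clE (c : {set gT}) g : c \in classes G -> g \in c -> c = (g ^: G)%g.
  by case/imsetP => x xG -> /class_eqP.
have nAB a b : a \in c7A -> b \in c7B -> b \notin (a ^: G)%g.
  move=> ca cb; apply: contra h7AB => /class_eqP.
  by rewrite (clE _ _ h7A ca) (clE _ _ h7B cb) => ->.
have nBA a b : a \in c7A -> b \in c7B -> a \notin (b ^: G)%g.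
  by move=> ca cb; rewrite class_sym nAB.
have [a0 ca0] : exists a, a \in c7A.
  by case/imsetP: h7A => x xG ->; exists x; exact: class_refl.
have [b0 cb0] : exists b, b \in c7B.
  by case/imsetP: h7B => x xG ->; exists x; exact: class_refl.
have PsiE := Psi_order7 R gT G C7 C3 hC7card hC3card hG hact.
have partA (u : gT -> R[i]) : is_classfun G u -> u 1%g = 1 ->
      forall a b, a \in c7A -> b \in c7B ->
        Psi G u a = cpow 2 (1 / 7 + 3 / 7 * (u a + u b)) - 1 /\
        Psi G u b = cpow 2 (1 / 7 + 3 / 7 * (u a + u b)) - 1.
  move=> uG u1 a b ca cb; have aG := inG _ _ h7A ca; have bG := inG _ _ h7B cb.
  split; first by apply: PsiE => //; [exact: h7Aord|exact: h7Bord|exact: nAB].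
  by rewrite [u a + u b]addrC; apply: PsiE => //; [exact: h7Bord|exact: h7Aord|exact: nBA].
have partA2 (u : gT -> R[i]) (z : R[i]) : is_classfun G u -> u 1%g = 1 ->
      (forall g, g \in c7A :|: c7B -> u g = z) ->
      forall g, g \in c7A :|: c7B -> Psi G u g = psiC z.
  move=> uG u1 uz g cg.
  have e : 1 / 7 + 3 / 7 * (z + z) = 1 / 7 + 6 / 7 * z by field.
  have uA a : a \in c7A -> u a = z by move=> h; apply: uz; rewrite inE h.
  have uB a : a \in c7B -> u a = z by move=> h; apply: uz; rewrite inE h orbT.
  rewrite /psiC -e; case/setUP: cg => cg.
    by rewrite (partA _ uG u1 _ _ cg cb0).1 (uA _ cg) (uB _ cb0).
  by rewrite (partA _ uG u1 _ _ ca0 cg).2 (uA _ ca0) (uB _ cg).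
split; first by split.
split; first exact: psiC_fixed_iff.
split; first exact: fixed_points_psi.
have [fixP [_ [_ [_ [_ [zb _]]]]]] := fixed_points_psi R.
have psiz : psi (z0 R) = z0 R by apply/fixP; right.
(* The two classes exhaust the elements of order 7: these are powers of [a0], and [classfun_pow7] is
   applied to the indicator of the union. *)
have c7P g : g \in G -> (g \in c7A :|: c7B) = (#[g]%g == 7%N).
  move=> gG; apply/idP/eqP => [/setUP[]|g7]; [exact: h7Aord|exact: h7Bord|].
  have [aG bG] := (inG _ _ h7A ca0, inG _ _ h7B cb0).
  have [a7 b7] := (h7Aord _ ca0, h7Bord _ cb0).
  have ucl : is_classfun G (fun x => x \in c7A :|: c7B).
    move=> x y xG yG; rewrite !inE (clE _ _ h7A ca0) (clE _ _ h7B cb0).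
    by rewrite !(class_transl _ (memJ_class _ yG)).
  have [u2 u4 u3 u5 u6] := classfun_pow7 _ _ _ _ hC7card hC3card hG hact
    _ _ ucl _ _ aG bG a7 b7 (nAB _ _ ca0 cb0).
  have : g \in <[a0]>%g.
    by rewrite (order7_cycle _ _ _ _ hC7card hC3card hG _ aG a7)
      -(order7_cycle _ _ _ _ hC7card hC3card hG _ gG g7) cycle_id.
  case/cycleP=> t0; rewrite -expg_mod_order a7; set t := (t0 %% 7)%N => gE.
  have t7 : (t < 7)%N by rewrite ltn_mod.
  move: g7; rewrite gE; move: t7; case: t {gE} => [|[|[|[|[|[|[|]]]]]]]// _.
  - by rewrite expg0 order1.
  - by rewrite expg1 inE ca0.
  - by rewrite u2 inE ca0.
  - by rewrite u3 inE cb0 orbT.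
  - by rewrite u4 inE ca0.
  - by rewrite u5 inE cb0 orbT.
  - by rewrite u6 inE cb0 orbT.
(* Conjugation and inversion preserve the order, and the values are real, so the symmetry conditions
   on [f] are immediate. *)
pose f (g : gT) : R[i] := if #[g]%g == 7%N then (z0 R)%:C else 1.
have fcl : is_classfun G f by move=> x y _ _; rewrite /f orderJ.
have f1 : f 1%g = 1 by rewrite /f order1.
have f7 g : g \in c7A :|: c7B -> f g = (z0 R)%:C.
  by case/setUP => [/h7Aord|/h7Bord] g7; rewrite /f g7.
exists f; split=> //; split=> //; split.
  move=> g gG; have [g7|g7] := eqVneq #[g]%g 7%N.
    have cg : g \in c7A :|: c7B by rewrite c7P// g7.
    have := partA2 f _ fcl f1 f7 g cg; rewrite psiC_real psiz -(f7 g cg) /Psi => <-.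
    by rewrite addrC subrK.
  have n7 := not_dvd7_order _ _ _ _ hC7card hC3card hG hact _ gG g7.
  have f1j j : f (g ^+ j)%g = 1.
    rewrite /f; case: eqP => // gj; case/negP: n7; rewrite -gj; exact: orderXdvd.
  rewrite wedge_one_on_powers// ?(card_G21 _ _ _ _ hC7card hC3card hG)//.
  by rewrite /f (negbTE g7).
split; first by move=> g _; rewrite /f orderV; case: ifP => _; rewrite ?conjc_real ?conjc1.
split=> //.
have aG := inG _ _ h7A ca0; have a7 := h7Aord _ ca0.
move=> /linear_character_sqr /(_ aG).
rewrite (classfun_sqr7 _ _ _ _ hC7card hC3card hG hact _ _ fcl _ aG a7).
rewrite (f7 a0) ?inE ?ca0// -rmorphXn => /complexI; move: zb.
rewrite ltr_norml => /andP[z1 z2]; nra.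
Qed.
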